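(* Let $(X,\mathbb{X},\mu)$ be a measure space, let $p\in[1,\infty)$, and let $M(X)$ be the space of measurable functions on $X$. Then the pair $(M(X),\alpha_p)$, where $\alpha_p$ denotes the relation of $\alpha_p$-convergence between sequences in $M(X)$ and elements of $M(X)$, is a sequential convergence class.
   Context: Measurable functions are $\mathbb{X}$-measurable real-valued functions on $X$; $(X,\mathbb{X},\mu)$ is an arbitrary measure space. For $B\in\mathbb{X}$, $B^c$ denotes the complement of $B$ in $X$. A sequence $(f_n)$ of measurable functions is said to $\alpha_p$-converge to a measurable function $f$, written $f_n\xrightarrow{\alpha_p}f$, if there exists a sequence of measurable sets $(B_n)$ with $\mu(B_n^c)\to 0$ as $n\to\infty$ such that $\int_{B_n}|f_n-f|^p\,d\mu\to 0$ as $n\to\infty$. A sequential convergence class is a pair $(M,\alpha)$, where $M$ is a set and $\alpha$ is a relation between sequences $(f_n)$ in $M$ and elements $f\in M$, denoted $f_n\xrightarrow{\alpha}f$, such that: (i) if $f_n=f$ for all $n\in\mathbb{N}$, then $f_n\xrightarrow{\alpha}f$; (ii) if $f_n\xrightarrow{\alpha}f$ and $(f_{k_n})$ is a subsequence of $(f_n)$, then $f_{k_n}\xrightarrow{\alpha}f$; (iii) if $f_n\xrightarrow{\alpha}f$ does not hold, then there exists a subsequence $(f_{k_n})$ of $(f_n)$ such that for every subsequence $(h_n)$ of $(f_{k_n})$, $h_n\xrightarrow{\alpha}f$ does not hold; (iv) if $f_n\xrightarrow{\alpha}f$ and, for each $n\in\mathbb{N}$, the sequence $(f_{n,k})_{k\in\mathbb{N}}$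 satisfies $f_{n,k}\xrightarrow{\alpha}f_n$ (as $k\to\infty$), then there exist indices $k_n\ge n$, one for each $n\in\mathbb{N}$, such that the sequence $(f_{n,k_n})_{n\in\mathbb{N}}$ satisfies $f_{n,k_n}\xrightarrow{\alpha}f$ (as $n\to\infty$). *)

(* Defs.v *)
From HB Require Import structures.
From mathcomp Require Import all_boot all_order all_algebra.
From mathcomp Require Import all_classical all_reals all_analysis.
Import Order.TTheory GRing.Theory Num.Theory.
Import numFieldNormedType.Exports.

Set Implicit Arguments.
Unset Strict Implicit.
Unset Printing Implicit Defensive.

Local Open Scope classical_set_scope.
Local Open Scope ring_scope.

(* The subsequences of f are the f \o k with k : nat -> nat strictly
   increasing; [increasing_seq k] unfolds to
   forall n m, (k n <= k m) = (n <= m), which says exactly that. *)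
Record seq_convergence_class (M : Type) (conv : (nat -> M) -> M -> Prop)
    : Prop := SeqConvergenceClass {
  scc_const : forall (f_ : nat -> M) (f : M),
    (forall n, f_ n = f) -> conv f_ f ;
  scc_subseq : forall (f_ : nat -> M) (f : M) (k : nat -> nat),
    increasing_seq k -> conv f_ f -> conv (f_ \o k) f ;
  scc_subsubseq : forall (f_ : nat -> M) (f : M),
    ~ conv f_ f ->
    exists2 k : nat -> nat, increasing_seq k &
      forall l : nat -> nat, increasing_seq l -> ~ conv ((f_ \o k) \o l) f ;
  scc_diagonal : forall (f_ : nat -> M) (f : M) (f__ : nat -> nat -> M),
    conv f_ f -> (forall n, conv (f__ n) (f_ n)) ->
    exists2 k : nat -> nat, (forall n, (n <= k n)%N) &
      conv (fun n => f__ n (k n)) f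
}.

(* The elements of {mfun T >-> R} are functions, not classes modulo almost
   everywhere equality. Both limits are taken in \bar R, so the measures and the
   integrals may be infinite for finitely many n. *)
Definition alpha_cvg (d : measure_display) (T : measurableType d)
    (R : realType) (mu : {measure set T -> \bar R}) (p : R)
    (f_ : nat -> {mfun T >-> R}) (f : {mfun T >-> R}) : Prop :=
  exists B : nat -> set T,
    [/\ (forall n, measurable (B n)),
        mu (~` B n) @[n --> \oo] --> 0%E &
        (\int[mu]_(x in B n) (`|f_ n x - f x| `^ p)%:E)%E @[n --> \oo] --> 0%E].

(* Main.v *)
Require Import Defs.
From HB Require Import structures.
From mathcomp Require Import all_boot all_order all_algebra.
From mathcomp Require Import all_classical all_reals all_analysis.
From mathcomp Require Import measurable_realfun.
Import Order.TTheory GRing.Theory Num.Theory.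
Import numFieldNormedType.Exports.
Local Open Scope ring_scope.

(** The relation alpha_p is convergence for a quasi-pseudometric, and every
    such convergence is a sequential convergence class.

    For a measurable u, let the gauge of u be the infimum over measurable B of
    mu (~` B) + \int_B |u|^p: what it costs to make u small in L^p after
    throwing away the complement of B. Choosing, for each n, a set B_n that is
    optimal up to 1 / (n + 1) turns convergence of the gauges of f_n - f to 0
    into a witness of alpha_p-convergence, and any witness bounds the gauges
    from above; this is [alpha_cvgE].

    The gauge satisfies a triangle inequality up to the factor 2^p
    ([excision_gaugeD]): intersect nearly optimal sets for u and v, so that the
    discarded parts add up, and use |a + b|^p <= 2^p (|a|^p + |b|^p) on what
    remains.

    Finally, let D be nonnegative, zero on the diagonal, with a triangle
    inequality up to a constant C. The axioms on constant sequences and on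
    subsequences hold because they hold for limits of the sequences D (f_n) f
    in \bar R. For the diagonal axiom, take k_n >= n with
    D (f_{n,k_n}) (f_n) < 1 / (n + 1); then D (f_{n,k_n}) f is at most
    C (1 / (n + 1) + D (f_n) f), which tends to 0. This is
    [quasi_pseudometric_convergence_class]. *)

Lemma increasing_seq_cvg (k : nat -> nat) :
  increasing_seq k -> (k @ \oo --> \oo)%classic.
Proof.
move=> /increasing_seqP kS; have kge n : (n <= k n)%N.
  by elim: n => // n IHn; exact: leq_ltn_trans IHn (kS n).
move=> A [N _ NA]; exists N => // n /= Nn; apply: NA.
exact: leq_trans (kge n).
Qed.

(** If u does not converge to a, some neighbourhood V of a is missed by
    infinitely many terms; enumerating these terms gives a subsequence that
    stays outside V, and so do all its subsequences. *)
Lemma not_cvg_subseq (U : topologicalType) (u : nat -> U) (a : U) :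
  ~ (u n @[n --> \oo] --> a)%classic ->
  exists2 k : nat -> nat, increasing_seq k &
    forall l : nat -> nat, increasing_seq l ->
      ~ (u (k (l n)) @[n --> \oo] --> a)%classic.
Proof.
move=> /existsNP[V] /not_implyP[aV uV].
pose A : set nat := [set n | ~ V (u n)]%classic.
have Afar m : exists n, A n /\ (m < n)%N.
  apply: contrapT => /forallNP far; apply: uV.
  exists m.+1 => // n /= mn; apply: contrapT => nV; exact: (far n).
(* The successor step asks for an index beyond the previous one, which makes
   the enumeration strictly increasing. *)
pose k := fix k n : nat := sval (cid (Afar (if n is m.+1 then k m else 0%N))).
have kA n : A (k n) by case: n => [|n] /=; case: cid => ? [].
have kS n : (k n < k n.+1)%N by rewrite [k n.+1]/=; case: cid => ? [].
exists k; first exact/increasing_seqP.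
by move=> l _ /(_ V aV)[N _ /(_ N (leqnn N))]; exact: kA.
Qed.

(** The diagonal axiom is the only one that compares distances: it goes from
    f__ n (k n) through f_ n to f, and the factor C is harmless because
    multiplication by a real constant preserves convergence to 0 in \bar R. *)
Lemma quasi_pseudometric_convergence_class (M : Type) (R : realType)
    (D : M -> M -> \bar R) (C : R) :
  0 <= C -> (forall f, D f f = 0%E) -> (forall f g, 0 <= D f g)%E ->
  (forall f g h, D f h <= C%:E * (D f g + D g h))%E ->
  seq_convergence_class (fun (f_ : nat -> M) (f : M) =>
    (D (f_ n) f @[n --> \oo] --> 0%E)%classic).
Proof.
move=> C0 D0 Dge0 Dtri; split.
- move=> f_ f f_f; have -> : (fun n => D (f_ n) f) = fun=> 0%E.
    by apply/funext => n; rewrite f_f.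
  exact: cvg_cst.
- move=> f_ f k /increasing_seq_cvg koo Df.
  exact: (cvg_comp _ _ koo Df).
- by move=> f_ f /not_cvg_subseq.
- move=> f_ f f__ Df Df__.
  have kex n : exists k : nat,
      (n <= k)%N /\ (D (f__ n k) (f_ n) < (harmonic n)%:E)%E.
    have V : nbhs (0 : \bar R)%E [set y | (y < (harmonic n)%:E)%E]%classic.
      apply: open_nbhs_nbhs; split; first exact: open_ereal_lt_ereal.
      by rewrite /= lte_fin harmonic_gt0.
    have [N _ NV] := Df__ n _ V.
    exists (maxn n N); rewrite leq_maxl; split => //.
    by apply: NV; exact: leq_maxr.
  have /choice[k k_spec] := kex.
  exists k => [n|]; first by have [] := k_spec n.
  apply: (@squeeze_cvge _ _ _ _ (fun=> 0%E) _
    (fun n => C%:E * ((harmonic n)%:E + D (f_ n) f)))%E.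
  + near=> n; rewrite Dge0 /= (le_trans (Dtri _ (f_ n) _))//.
    by rewrite lee_wpmul2l ?lee_fin// leeD2r// ltW//; have [] := k_spec n.
  + exact: cvg_cst.
  + rewrite -[X in (_ --> X)%classic](mule0 C%:E); apply: cvgeZl => //.
    rewrite -[X in (_ --> X)%classic](adde0 0%E); apply: cvgeD => //.
    exact: cvge_harmonic.
Unshelve. all: by end_near.
Qed.

(** Since |a + b| is at most twice the larger of |a| and |b|, monotonicity of
    the power gives the constant 2^p for every p >= 0. The constant 2^(p-1) of
    the convex case p >= 1 would only improve the factor in the triangle
    inequality, whose size is irrelevant to convergence. *)
Lemma powR_normD_le (R : realType) (p a b : R) : (0 <= p)%R ->
  (`|a + b| `^ p <= 2 `^ p * (`|a| `^ p + `|b| `^ p))%R.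
Proof.
move=> p0; wlog ab : a b / (`|a| <= `|b|)%R => [th|].
  have [/th//|/ltW/th] := leP `|a|%R `|b|%R.
  by rewrite addrC [X in (_ * X)%R]addrC.
apply: (@le_trans _ _ ((2 * `|b|) `^ p)%R).
  apply: ge0_ler_powR => //; rewrite ?nnegrE ?mulr_ge0//.
  by rewrite (le_trans (ler_normD _ _))// mulr_natl mulr2n lerD2r.
by rewrite powRM// ler_wpM2l ?powR_ge0// lerDr powR_ge0.
Qed.

Section ExcisionGauge.
Set Implicit Arguments.
Unset Strict Implicit.
Context (d : measure_display) (T : measurableType d) (R : realType).
Context (mu : {measure set T -> \bar R}) (p : R).
Local Open Scope classical_set_scope.
Local Open Scope ereal_scope.

Definition excision_cost (u : T -> R) (B : set T) : \bar R :=
  mu (~` B) + \int[mu]_(x in B) (`|u x| `^ p)%:E.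

(** An analogue of the Ky Fan functional of convergence in measure, with the
    integral of |u|^p over the retained set in place of a uniform bound. It can
    be +oo. *)
Definition excision_gauge (u : T -> R) : \bar R :=
  ereal_inf [set excision_cost u B | B in measurable].

Lemma excised_integral_ge0 (u : T -> R) (B : set T) :
  0 <= \int[mu]_(x in B) (`|u x| `^ p)%:E.
Proof. by apply: integral_ge0 => x _; rewrite lee_fin powR_ge0. Qed.

Lemma excision_gauge_ge0 (u : T -> R) : 0 <= excision_gauge u.
Proof.
apply: le_ereal_inf_tmp => _ [B _ <-].
by rewrite adde_ge0// excised_integral_ge0.
Qed.

Lemma excision_gauge_le (u : T -> R) (B : set T) :
  measurable B -> excision_gauge u <= excision_cost u B.
Proof. by move=> mB; apply: ereal_inf_lbound; exists B. Qed.

(** The infimum need not be attained, but it is up to e; when it is +oo every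
    set will do. *)
Lemma excision_gauge_adherent (u : T -> R) (e : R) : (0 < e)%R ->
  exists2 B, measurable B & excision_cost u B <= excision_gauge u + e%:E.
Proof.
move=> e0; have [ufin|] := boolP (excision_gauge u \is a fin_num).
  by have [_ [B mB <-] /ltW] := lb_ereal_inf_adherent e0 ufin; exists B.
rewrite ge0_fin_numE ?excision_gauge_ge0// ltey negbK => /eqP ->.
by exists setT => //; rewrite leey.
Qed.

Lemma excision_gauge0 : (0 < p)%R -> excision_gauge (fun=> 0%R) = 0.
Proof.
move=> p0; apply/eqP; rewrite eq_le excision_gauge_ge0 andbT.
apply: (le_trans (excision_gauge_le _ measurableT)).
rewrite /excision_cost setCT measure0 add0e integral0_eq// => x _.
by rewrite normr0 powR0// gt_eqF.
Qed.

Lemma measurable_fun_powR_norm (w : T -> R) (E : set T) :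
  measurable_fun setT w -> measurable_fun E (fun x => (`|w x| `^ p)%:E).
Proof.
move=> mw; apply: measurable_funTS; apply/measurable_EFinP => /=.
apply: (measurableT_comp (measurable_powR _)).
exact: measurableT_comp.
Qed.

Lemma excised_integralD (u v : T -> R) (E : set T) : (0 <= p)%R ->
  measurable_fun setT u -> measurable_fun setT v -> measurable E ->
  \int[mu]_(x in E) (`|(u \+ v)%R x| `^ p)%:E <=
    (2 `^ p)%:E * (\int[mu]_(x in E) (`|u x| `^ p)%:E +
                   \int[mu]_(x in E) (`|v x| `^ p)%:E).
Proof.
move=> p0 mfu mfv mE.
have pow_ge0 (w : T -> R) x : E x -> 0 <= (`|w x| `^ p)%:E.
  by rewrite lee_fin powR_ge0.
have mpow (w : T -> R) := @measurable_fun_powR_norm w E.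
rewrite -ge0_integralD//; [|exact: mpow|exact: mpow].
rewrite -ge0_integralZl_EFin ?powR_ge0//; last 2 first.
- by move=> x Ex; rewrite adde_ge0 ?pow_ge0.
- by apply: emeasurable_funD; exact: mpow.
apply: ge0_le_integral => //.
- exact: (mpow (u \+ v)%R (measurable_funD mfu mfv)).
- by apply: measurable_funeM; apply: emeasurable_funD; exact: mpow.
- by move=> x _; rewrite -EFinD -EFinM lee_fin; exact: powR_normD_le.
Qed.

Lemma le_excised_integral (u : T -> R) (A B : set T) :
  measurable_fun setT u -> measurable A -> measurable B -> A `<=` B ->
  \int[mu]_(x in A) (`|u x| `^ p)%:E <= \int[mu]_(x in B) (`|u x| `^ p)%:E.
Proof.
move=> mfu mA mB AB; apply: ge0_subset_integral => //.
exact: measurable_fun_powR_norm.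
Qed.

(** Retaining A `&` B discards at most ~` A and ~` B together; as 2^p >= 1, the
    factor needed for the integrals also covers the measures. *)
Lemma excision_costD (u v : T -> R) (A B : set T) : (0 <= p)%R ->
  measurable_fun setT u -> measurable_fun setT v ->
  measurable A -> measurable B ->
  excision_cost (u \+ v)%R (A `&` B) <=
    (2 `^ p)%:E * (excision_cost u A + excision_cost v B).
Proof.
move=> p0 mfu mfv mA mB; have mAB : measurable (A `&` B) by exact: measurableI.
rewrite /excision_cost addeACA.
rewrite ge0_muleDr; last 2 first.
- exact: adde_ge0.
- by apply: adde_ge0; exact: excised_integral_ge0.
apply: leeD.
  apply: (@le_trans _ _ (mu (~` A) + mu (~` B))).
    by rewrite setCI measureU2//; exact: measurableC.
  by rewrite lee_pemull ?adde_ge0// lee_fin -[leLHS](powRr0 2) ler_powR// ler1n.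
apply: (le_trans (excised_integralD p0 mfu mfv mAB)).
apply: lee_wpmul2l; first by rewrite lee_fin powR_ge0.
by apply: leeD; exact: le_excised_integral.
Qed.

Lemma excision_gaugeD (u v : T -> R) : (0 <= p)%R ->
  measurable_fun setT u -> measurable_fun setT v ->
  excision_gauge (u \+ v)%R <=
    (2 `^ p)%:E * (excision_gauge u + excision_gauge v).
Proof.
move=> p0 mfu mfv; apply/lee_addgt0Pr => e e0.
(* The slack e / 2 / 2^p, spent once for u and once for v and then multiplied
   by 2^p, adds up to e. *)
have C0 : (0 < 2 `^ p :> R)%R by rewrite powR_gt0.
have e'0 : (0 < e / 2 / 2 `^ p)%R by rewrite !divr_gt0.
have [A mA uA] := excision_gauge_adherent u e'0.
have [B mB vB] := excision_gauge_adherent v e'0.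
apply: (le_trans (excision_gauge_le _ (measurableI _ _ mA mB))).
apply: (le_trans (excision_costD p0 mfu mfv mA mB)).
apply: (@le_trans _ _ ((2 `^ p)%:E * (excision_gauge u + (e / 2 / 2 `^ p)%:E +
    (excision_gauge v + (e / 2 / 2 `^ p)%:E)))).
  by apply: lee_wpmul2l; [rewrite lee_fin ltW|exact: (leeD uA vB)].
rewrite addeACA ge0_muleDr; last 2 first.
- by apply: adde_ge0; exact: excision_gauge_ge0.
- by rewrite -EFinD lee_fin addr_ge0// ltW.
rewrite leeD2l// -EFinD -EFinM lee_fin.
by rewrite -mulrDl -splitr mulrC divfK// gt_eqF.
Qed.

(** The witnessing sets are near-minimizers of the cost, with error 1 / (n + 1);
    both terms of the cost are nonnegative, so each is squeezed to 0. *)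
Lemma alpha_cvgE (f_ : nat -> {mfun T >-> R}) (f : {mfun T >-> R}) :
  alpha_cvg mu p f_ f <->
  excision_gauge (fun x => f_ n x - f x)%R @[n --> \oo] --> 0.
Proof.
split=> [[B [mB muB intB]]|gauge0].
  apply: (@squeeze_cvge _ _ _ _ (fun=> 0) _
    (fun n => excision_cost (fun x => f_ n x - f x)%R (B n))).
  - by near=> n; rewrite excision_gauge_ge0 excision_gauge_le.
  - exact: cvg_cst.
  - by rewrite -[X in _ --> X](adde0 0); apply: cvgeD.
have /choice[B B_spec] : forall n, exists B, measurable B /\
    excision_cost (fun x => f_ n x - f x)%R B <=
    excision_gauge (fun x => f_ n x - f x)%R + (harmonic n)%:E.
  move=> n.
  have [B] := excision_gauge_adherent (fun x => f_ n x - f x)%R (harmonic_gt0 n).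
  by exists B.
have cost0 : excision_gauge (fun x => f_ n x - f x)%R + (harmonic n)%:E
    @[n --> \oo] --> 0.
  rewrite -[X in _ --> X](adde0 0); apply: cvgeD => //.
  exact: cvge_harmonic.
exists B; split; first by move=> n; have [] := B_spec n.
- apply: (squeeze_cvge _ (cvg_cst 0) cost0); near=> n.
  have [_] := B_spec n; rewrite measure_ge0 /=; apply: le_trans.
  by rewrite leeDl// excised_integral_ge0.
- apply: (squeeze_cvge _ (cvg_cst 0) cost0); near=> n.
  have [_] := B_spec n; rewrite excised_integral_ge0 /=; apply: le_trans.
  by rewrite leeDr.
Unshelve. all: by end_near.
Qed.

End ExcisionGauge.

Theorem theorem4p5 (d : measure_display) (T : measurableType d) (R : realType)
  (mu : {measure set T -> \bar R}) (p : R) (hp : 1 <= p) :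
  seq_convergence_class (alpha_cvg mu p).
Proof.
have p0 : 0 < p by exact: lt_le_trans hp.
have -> : alpha_cvg mu p = fun (f_ : nat -> {mfun T >-> R}) f =>
    (excision_gauge mu p (fun x => f_ n x - f x) @[n --> \oo] --> 0%E)%classic.
  by apply/funext => f_; apply/funext => f; apply/propext; exact: alpha_cvgE.
apply: (quasi_pseudometric_convergence_class _ _
  (fun f g : {mfun T >-> R} => excision_gauge mu p (fun x => f x - g x))
  (2 `^ p)).
- exact: powR_ge0.
- move=> f; under eq_fun do rewrite subrr.
  exact: excision_gauge0.
- by move=> f g; exact: excision_gauge_ge0.
- move=> f g h.
  have -> : (fun x => f x - h x) =
      ((fun x => f x - g x) \+ (fun x => g x - h x)).
    by apply/funext => x /=; rewrite addrA subrK.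
  by apply: excision_gaugeD; [exact: ltW|exact: measurable_funB..].
Qed.
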